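(* Let $p$ be a pattern. Then $p$ is avoidable in the ordinary sense if and only if $p$ is avoidable up to $\simeq$.
   Context: A pattern is a word $p=p_1\cdots p_n$ over an alphabet of variables. For an equivalence relation $\sim$ on words, a word $w$ encounters $p$ up to $\sim$ if $w$ has a factor $X_1X_2\cdots X_n$ with each $X_i$ a nonempty word and $X_i\sim X_j$ whenever $p_i=p_j$; otherwise $w$ avoids $p$ up to $\sim$. The pattern $p$ is $k$-avoidable up to $\sim$ if some infinite word over a $k$-letter alphabet avoids $p$ up to $\sim$, and avoidable up to $\sim$ if it is $k$-avoidable up to $\sim$ for some $k$. ''Ordinary sense'' means $\sim$ is equality. The relation $\simeq$ is defined by $x\simeq x'$ iff $x'\in\{x,x^R\}$, where $x^R$ is the reversal of $x$. *)

(* Defs.v *)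
From mathcomp Require Import all_boot.

Set Implicit Arguments.
Unset Strict Implicit.
Unset Printing Implicit Defensive.

Definition inf_word (A : Type) := nat -> A.

Definition inf_factor (A : Type) (w : inf_word A) (u : seq A) : Prop :=
  exists m : nat, u = [seq w i | i <- iota m (size u)].

(* A relation on words is given uniformly over all alphabets, since
   avoidability quantifies over the alphabet. *)
Definition word_rel := forall A : Type, seq A -> seq A -> Prop.

Definition rel_eq : word_rel := fun A x y => x = y.

Definition rel_rev : word_rel := fun A x y => y = x \/ y = rev x.

(* The empty pattern is allowed: every word encounters it. *)
Definition encounters (sim : word_rel) (V : eqType) (p : seq V)
    (A : Type) (w : inf_word A) : Prop :=
  exists X : (size p).-tuple (seq A),
    [/\ forall i, tnth X i <> [::],
        forall i j, tnth (in_tuple p) i = tnth (in_tuple p) j ->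
          sim A (tnth X i) (tnth X j)
      & inf_factor w (flatten X)].

Definition avoids (sim : word_rel) (V : eqType) (p : seq V)
    (A : Type) (w : inf_word A) : Prop := ~ encounters sim p w.

Definition k_avoidable (sim : word_rel) (V : eqType) (k : nat) (p : seq V)
    : Prop := exists w : inf_word 'I_k, avoids sim p w.

Definition avoidable (sim : word_rel) (V : eqType) (p : seq V) : Prop :=
  exists k : nat, k_avoidable sim k p.

(* Main.v *)
Require Import Defs.
From mathcomp Require Import all_boot.
From mathcomp Require Import zify.

(** Label the letters of a word avoiding [p] by their positions modulo 3.  A
    factor of length at least 2 of the labelled word contains some [i, i+1] among
    its labels, so its reversal contains [i+1, i] and is not a factor.  Two
    factors equal up to reversal are therefore equal. *)

Lemma inf_factor_map (A B : Type) (f : A -> B) (w : inf_word A) (u : seq A) :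
  inf_factor w u -> inf_factor (f \o w) (map f u).
Proof. by case=> m ->; exists m; rewrite !size_map size_iota -map_comp. Qed.

Lemma inf_factor_infix (A : Type) (w : inf_word A) (s1 s2 s3 : seq A) :
  inf_factor w (s1 ++ s2 ++ s3) -> inf_factor w s2.
Proof.
case=> m; rewrite !size_cat !iotaD !map_cat => /(congr1 (drop (size s1))).
rewrite !drop_size_cat ?size_map ?size_iota // => /(congr1 (take (size s2))).
by rewrite !take_size_cat ?size_map ?size_iota // => ->;
   exists (m + size s1); rewrite size_map size_iota.
Qed.

Lemma inf_factor_tnth (A : Type) (w : inf_word A) (n : nat)
    (X : n.-tuple (seq A)) (i : 'I_n) :
  inf_factor w (flatten X) -> inf_factor w (tnth X i).
Proof.
have ltiX : i < size X by rewrite size_tuple.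
rewrite (tnth_nth [::]) -{1}(cat_take_drop i X) (drop_nth [::] ltiX).
by rewrite flatten_cat /=; apply: inf_factor_infix.
Qed.

Lemma inf_factor_rev_mod3 (A : Type) (c : A -> nat) (w : inf_word A)
    (u : seq A) :
  (forall i, c (w i) = i %% 3) ->
  inf_factor w u -> inf_factor w (rev u) -> rev u = u.
Proof.
move=> cw; case: u => [|x [|y s]] // [m [xE yE _]] uR_factor.
(* Words of length below 2 are palindromes. Here [u] starts with [x], [y], so [rev u] ends with [y],
   [x]; this leads to a contradiction. *)
have : inf_factor w [:: y; x].
  by apply: (@inf_factor_infix _ _ (rev s) _ [::]);
     move: uR_factor; rewrite !rev_cons -!cats1 -catA.
case=> m' [yE' xE'].
have := cw m; rewrite -xE xE' cw => eq_x.
have := cw m.+1; rewrite -yE yE' cw => eq_y.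
(* Now [m] is [m' + 1] and [m + 1] is [m'] modulo 3, so 3 would divide 2. Labels modulo 2 would give
   no contradiction. *)
lia.
Qed.

(** If two blocks of an encounter are reversals of each other, both are factors of [w], hence equal.
    Erasing the labels by [f] keeps these equalities and the nonemptiness of blocks. Here [c] reads
    the label off a letter. *)
Lemma avoids_rev_mod3 (V : eqType) (p : seq V) (A B : Type) (f : A -> B)
    (c : A -> nat) (w : inf_word A) :
  (forall i, c (w i) = i %% 3) ->
  avoids rel_eq p (f \o w) -> avoids rel_rev p w.
Proof.
move=> cw avoid_p [X [X_neq0 X_rev X_factor]]; apply: avoid_p.
exists (map_tuple (map f) X); split=> [i|i j eq_p|].
- by rewrite tnth_map; move: (X_neq0 i); case: (tnth X i).
- rewrite !tnth_map /rel_eq; congr map.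
  have [//|eqR] := X_rev i j eq_p.
  rewrite eqR (inf_factor_rev_mod3 _ _ _ _ cw) -?eqR //;
    exact: inf_factor_tnth.
- by rewrite /= -map_flatten; apply: inf_factor_map.
Qed.

Theorem theorem6 (V : eqType) (p : seq V) :
  avoidable rel_eq p <-> avoidable rel_rev p.
Proof.
split=> [] [k [w avoid_p]].
- pose letter : finType := ('I_k * 'I_3)%type.
  (* [enum_rank] codes the labelled letters as ordinals, as [k_avoidable] requires. *)
  exists #|letter|, (fun i => enum_rank ((w i, inord (i %% 3)) : letter)).
  pose label (x : 'I_#|letter|) : nat := (enum_val x).2.
  apply: (@avoids_rev_mod3 _ _ _ _ (fun x => (enum_val x).1) label)
    => [i|[X [X_neq0 X_eq X_factor]]].
    by rewrite /label enum_rankK /= inordK // ltn_mod.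
  apply: avoid_p; exists X; split=> //.
  (* The word with labels erased agrees with [w] pointwise, which suffices to carry the factor
     over. *)
  case: X_factor => m ->; exists m; rewrite size_map size_iota.
  by apply: eq_map => i; rewrite /= enum_rankK.
(* The same word works, since equal words are equal up to reversal. *)
- exists k, w => -[X [X_neq0 X_eq X_factor]]; apply: avoid_p.
  by exists X; split=> // i j eq_p; left; rewrite (X_eq i j eq_p).
Qed.
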